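(* Let $n\ge3$. On the round sphere $\mathbb S^n$, $$\mathcal M_{2N}=N!\,(N-1)!\,P_2\qquad\text{for all }N\ge1 .$$
   Context: $\Delta$ is the Laplacian of the unit round sphere $\mathbb S^n$ with $-\Delta\ge0$. The GJMS-operators of $\mathbb S^n$ are given, for all $N\ge1$, by $P_{2N}=\prod_{j=n/2}^{n/2+N-1}(\Delta-j(n-1-j))$ (the index $j$ runs over $\frac n2,\frac n2+1,\dots,\frac n2+N-1$); equivalently $P_{2N}=\prod_{j=0}^{N-1}(P_2+j(j+1))$ with $P_2=\Delta-\frac n2(\frac n2-1)$. For a composition $I=(I_1,\dots,I_r)$ (finite sequence of integers $I_j\ge1$) put $|I|=I_1+\dots+I_r$, $P_{2I}=P_{2I_1}\circ\cdots\circ P_{2I_r}$ and $$m_I=-(-1)^r|I|!\,(|I|-1)!\prod_{j=1}^r\frac1{I_j!\,(I_j-1)!}\prod_{j=1}^{r-1}\frac1{I_j+I_{j+1}}.$$ Define $\mathcal M_{2N}=\sum_{|I|=N}m_IP_{2I}$, the sum running over all compositions $I$ of $N$. *)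

(* Defs.v *)
From HB Require Import structures.
From mathcomp Require Import all_boot all_order all_algebra.
From mathcomp Require Import all_classical all_reals all_analysis.

Set Implicit Arguments.
Unset Strict Implicit.
Unset Printing Implicit Defensive.

Import Order.TTheory GRing.Theory Num.Theory.
Import numFieldNormedType.Exports.

Local Open Scope classical_set_scope.
Local Open Scope ring_scope.

(* The canonical norm of 'rV[R]_m is the sup norm (it has the right topology);
   the sphere needs the Euclidean one. *)
Definition enorm (R : realType) (m : nat) (x : 'rV[R]_m) : R :=
  Num.sqrt (\sum_(i < m) x ord0 i ^+ 2).

Definition sphere (R : realType) (n : nat) : Type :=
  {x : 'rV[R]_n.+1 | enorm x == 1}.

Definition partial (R : realType) (m : nat) (i : 'I_m) (F : 'rV[R]_m -> R) :
    'rV[R]_m -> R :=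
  fun x => 'D_(delta_mx ord0 i) F x.

Fixpoint Ck (R : realType) (m : nat) (k : nat) (U : set 'rV[R]_m)
    (F : 'rV[R]_m -> R) : Prop :=
  (forall x, U x -> {for x, continuous F}) /\
  if k is k'.+1 then
    forall i : 'I_m,
      (forall x, U x -> derivable F x (delta_mx ord0 i)) /\
      Ck k' U (partial i F)
  else True.

(* x |-> f (x / |x|) for x != 0 (the value at 0 is irrelevant). *)
Definition radial_ext (R : realType) (n : nat) (f : sphere R n -> R) :
    'rV[R]_n.+1 -> R :=
  fun x => if insub ((enorm x)^-1 *: x) is Some p then f p else 0.

(* Since x |-> x / |x| is a smooth submersion of R^(n+1) \ {0} onto S^n, f is
   smooth on S^n exactly when its radial extension is smooth off the origin. *)
Definition smooth (R : realType) (n : nat) (f : sphere R n -> R) : Prop :=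
  forall k : nat, Ck k [set x | x != 0] (radial_ext f).

(* The i-th component, in R^(n+1), of the tangential gradient.  The radial
   extension has vanishing normal derivative, so its Euclidean gradient at a
   point of the sphere is tangent to the sphere and represents df there. *)
Definition tangential_derivative (R : realType) (n : nat) (i : 'I_n.+1)
    (f : sphere R n -> R) : sphere R n -> R :=
  fun p => partial i (radial_ext f) (val p).

(* Tangent vector fields on S^n are given by their components in R^(n+1). *)
Definition gradient (R : realType) (n : nat) (f : sphere R n -> R) :
    'I_n.+1 -> sphere R n -> R :=
  fun i => tangential_derivative i f.

(* The Riemannian divergence of a tangent field X is the trace over T_p S^n of
   v |-> (D_v X)^tan.  It is the full Euclidean trace of the derivative of the
   radial extension of X, whose derivative in the normal direction is 0. *)
Definition divergence (R : realType) (n : nat)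
    (X : 'I_n.+1 -> sphere R n -> R) : sphere R n -> R :=
  fun p => \sum_(i < n.+1) tangential_derivative i (X i) p.

Definition laplacian (R : realType) (n : nat) (f : sphere R n -> R) :
    sphere R n -> R :=
  divergence (gradient f).

(* GJMS N is P_{2N}; the index j of the product is n/2 + k with 0 <= k < N,
   a half-integer when n is odd. *)
Definition GJMS_factor (R : realType) (n : nat) (j : R) (f : sphere R n -> R) :
    sphere R n -> R :=
  laplacian f - (j * (n%:R - 1 - j)) *: f.

Definition GJMS (R : realType) (n N : nat) :
    (sphere R n -> R) -> sphere R n -> R :=
  \big[comp/id]_(k < N) GJMS_factor (n%:R / 2 + k%:R).

(* P_{2I} = P_{2 I_1} \o ... \o P_{2 I_r} *)
Definition GJMS_seq (R : realType) (n : nat) (I : seq nat) :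
    (sphere R n -> R) -> sphere R n -> R :=
  \big[comp/id]_(i <- I) GJMS (R := R) (n := n) i.

Definition mcoef (R : realType) (I : seq nat) : R :=
  - (-1) ^+ size I * ((sumn I)`!)%:R * ((sumn I).-1`!)%:R
  * (\prod_(i <- I) ((i`! * i.-1`!)%:R)^-1)
  * (\prod_(j < (size I).-1) ((nth 0%N I j + nth 0%N I j.+1)%:R)^-1).

Definition is_composition (N : nat) (I : seq nat) : bool :=
  all (fun i => 0 < i)%N I && (sumn I == N).

(* calM N is M_{2N}.  A composition of N has length at most N and entries at most N, so the
   sum below runs over all compositions of N. *)
Definition calM (R : realType) (n N : nat) (f : sphere R n -> R) :
    sphere R n -> R :=
  \sum_(r < N.+1)
    \sum_(I : r.-tuple 'I_N.+1 | is_composition N (map val I))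
      mcoef R (map val I) *: GJMS_seq (map val I) f.

(* Main.v *)
Require Import Defs.
From HB Require Import structures.
From mathcomp Require Import all_boot all_order all_algebra.
From mathcomp Require Import all_classical all_reals all_analysis.
From mathcomp Require Import ring zify.

(** The Laplacian acts linearly on smooth functions and preserves smoothness, so
    on a smooth function polynomials in P_2 compose as they should.  The factors of
    P_(2j) are P_2 + k(k+1) for k < j, hence P_(2j) is p_j(P_2) with
    p_j(x) = prod_(k < j) (x + k(k+1)) ([GJMS_polyact]).
    What has to be proved is then the polynomial identity
      sum_I m_I prod_j p_(I_j)(x) = N! (N-1)! x      ([sum_mcoef_gjms_value]),
    and it may be checked at each real number x.

    Put a_l = p_l / (l! (l-1)!).  Up to the factor N! (N-1)! the summand is
    a_(I_1) times the chain of the factors - a_(I_(j+1)) / (I_j + I_(j+1)).  Sum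
    such chains over the compositions of M, with a first factor that refers to a
    given predecessor k: the sums B_k(M) obey
      B_k(M) = - sum_(l = 1)^M a_l B_l(M - l) / (k + l),   B_k(0) = 1,
    and the identity reads sum_l a_l B_l(N - l) = x.  The point is that B_k(M) has
    a closed form.  With theta = z d/dz, consider the Fuchsian equation
      theta (theta + k) y = - x z / (1 - z)^2 y,
    whose exponents at 0 are 0 and - k.  In the variable z / (1 - z) it becomes
    hypergeometric, and its regular solution is
      y = sum_j p_j(x) / ((1 + k) ... (j + k) j!) (- z / (1 - z))^j;
    B_k(M) is the coefficient of z^M.  As a function of k, this coefficient is a
    sum of simple fractions with poles at k = - 1, ..., - M.  Its residue at
    k = - l is, up to a factor, a coefficient of the solution that the equation
    with k = - l has for the exponent l; as theta (theta - l) z^l = z^l (theta + l) theta, that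
    solution is a multiple of z^l times the regular solution for k = + l
    ([frobenius_resonance]).  So the residue is - a_l B_l(M - l), and the
    expansion in simple fractions is the recursion ([frob_partial_fractions]).
    The sum of the residues is read off from the closed form, where only j = 1
    survives: it is - p_1(x) = - x ([sum_normalized_gjms_frob1]). *)

Set Implicit Arguments.
Unset Strict Implicit.
Unset Printing Implicit Defensive.

Import Order.TTheory GRing.Theory Num.Theory.
Import numFieldNormedType.Exports.

Local Open Scope ring_scope.
Local Open Scope classical_set_scope.

(** * Smooth functions on the sphere *)

(** A directional derivative is the derivative of a function of one real
    variable, for which the chain rule is at hand. *)
Lemma is_derive_line (R : realType) (m : nat) (F : 'rV[R]_m -> R)
    (x v : 'rV[R]_m) (d : R) :
  is_derive x v F d <-> is_derive (0 : R) 1 (fun h : R => F (h *: v + x)) d.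
Proof.
have E : 'D_v F x = 'D_1 (fun h : R => F (h *: v + x)) 0.
  rewrite /derive.
  have -> : (fun h : R => h^-1 *: ((F \o shift x) (h *: v) - F x)) =
    (fun h : R => h^-1 *: (((fun h : R => F (h *: v + x)) \o shift 0) (h *: 1)
                           - F (0 *: v + x))) => //.
  by apply/funext => h /=; rewrite addr0 scale0r add0r [_%:A]mulr1.
split=> -[dF <-]; constructor; rewrite ?E //.
  exact: (derivable1P F x v).1.
exact: (derivable1P F x v).2.
Qed.

Section Ck.
Context (R : realType) (m : nat).
Implicit Types (U : set 'rV[R]_m) (F G : 'rV[R]_m -> R) (k : nat).

Lemma Ck_continuous k U F x : Ck k U F -> U x -> {for x, continuous F}.
Proof. by case: k => [|k] [cF _]; apply: cF. Qed.

Lemma Ck_derivable k U F i x :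
  Ck k.+1 U F -> U x -> derivable F x (delta_mx ord0 i).
Proof. by move=> [_ /(_ i) [dF _]]; apply: dF. Qed.

Lemma Ck_partial k U F i : Ck k.+1 U F -> Ck k U (partial i F).
Proof. by move=> [_ /(_ i) []]. Qed.

Lemma CkW k U F : Ck k.+1 U F -> Ck k U F.
Proof.
elim: k F => [|k IHk] F CF; first by split=> // x; exact: (Ck_continuous CF).
split=> [x|i]; first exact: (Ck_continuous CF).
split=> [x|]; first exact: (Ck_derivable CF).
by apply: IHk; exact: Ck_partial CF.
Qed.

(** The formulas for the derivatives of radial extensions hold only off the
    origin, so regularity on an open set must depend only on the values there. *)
Lemma Ck_congr k U F G :
  open U -> (forall x, U x -> F x = G x) -> Ck k U F -> Ck k U G.
Proof.
move=> oU; elim: k F G => [|k IHk] F G FG CF.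
  split=> // x Ux.
  have nFG : \forall y \near x, F y = G y.
    near=> y; apply: FG; near: y; exact: open_nbhs_nbhs.
  rewrite /prop_for /continuous_at -(FG x Ux).
  exact: cvg_trans (near_eq_cvg nFG) (Ck_continuous CF Ux).
have nFG x : U x -> \forall y \near x, F y = G y.
  by move=> Ux; near=> y; apply: FG; near: y; exact: open_nbhs_nbhs.
split=> [x Ux|i]; first exact: Ck_continuous (IHk F G FG (CkW CF)) Ux.
split=> [x Ux|].
  exact: near_eq_derivable (nFG x Ux) (Ck_derivable CF Ux).
apply: (IHk (partial i F)); last exact: Ck_partial CF.
move=> x Ux; exact: near_eq_derive (nFG x Ux).
Unshelve. all: by end_near. Qed.

Lemma Ck_cst k U (a : R) : Ck k U (fun=> a).
Proof.
elim: k a => [|k IHk] a; first by split=> // x _; exact: cst_continuous.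
split=> [x _|i]; first exact: cst_continuous.
split=> [x _|]; first exact: derivable_cst.
rewrite (_ : partial i _ = fun=> 0); first exact: IHk.
by apply/funext => x; rewrite /partial (derive_cst a).
Qed.

Lemma CkD k U F G : open U -> Ck k U F -> Ck k U G -> Ck k U (F + G).
Proof.
move=> oU; elim: k F G => [|k IHk] F G CF CG.
  by split=> // x Ux; apply: continuousD;
      [exact: Ck_continuous CF Ux|exact: Ck_continuous CG Ux].
split=> [x Ux|i].
  apply: continuousD; [exact: Ck_continuous CF Ux|exact: Ck_continuous CG Ux].
split=> [x Ux|].
  apply: derivableD; [exact: Ck_derivable CF Ux|exact: Ck_derivable CG Ux].
apply: (Ck_congr (F := partial i F + partial i G)) => //.
  move=> x Ux; rewrite /partial deriveD //;
  [exact: Ck_derivable CF Ux|exact: Ck_derivable CG Ux].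
by apply: IHk; exact: Ck_partial.
Qed.

Lemma CkM k U F G : open U -> Ck k U F -> Ck k U G -> Ck k U (F * G).
Proof.
move=> oU; elim: k F G => [|k IHk] F G CF CG.
  by split=> // x Ux; apply: continuousM;
      [exact: Ck_continuous CF Ux|exact: Ck_continuous CG Ux].
split=> [x Ux|i].
  apply: continuousM; [exact: Ck_continuous CF Ux|exact: Ck_continuous CG Ux].
split=> [x Ux|].
  apply: derivableM; [exact: Ck_derivable CF Ux|exact: Ck_derivable CG Ux].
apply: (Ck_congr (F := F * partial i G + G * partial i F)) => //.
  move=> x Ux; rewrite /partial deriveM //;
  [exact: Ck_derivable CF Ux|exact: Ck_derivable CG Ux].
by apply: CkD => //; apply: IHk;
  [exact: CkW|exact: Ck_partial|exact: CkW|exact: Ck_partial].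
Qed.

Lemma is_derive_coord (x v : 'rV[R]_m) (j : 'I_m) :
  is_derive x v (fun y : 'rV[R]_m => y ord0 j) (v ord0 j).
Proof.
apply/is_derive_line.
rewrite (_ : (fun h => _) = (v ord0 j \*: id + cst (x ord0 j))).
  apply: is_derive_eq.
  by rewrite addr0 [_%:A]mulr1.
by apply/funext => h /=; rewrite !mxE mulrC.
Qed.

Lemma CkX k U F e : open U -> Ck k U F -> Ck k U (F ^+ e).
Proof.
move=> oU CF; elim: e => [|e IHe]; first exact: Ck_cst.
by rewrite exprS; apply: CkM.
Qed.

Lemma Ck_sum k U (I : Type) (r : seq I) (P : pred I) (F : I -> 'rV[R]_m -> R) :
  open U -> (forall i, P i -> Ck k U (F i)) -> Ck k U (\sum_(i <- r | P i) F i).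
Proof.
move=> oU CF; elim/big_ind: _ => [|G H|//]; first exact: Ck_cst.
exact: CkD.
Qed.

Lemma Ck_coord k U (j : 'I_m) : Ck k U (fun x => x ord0 j).
Proof.
case: k => [|k]; first by split=> // x _; exact: coord_continuous.
split=> [x _|i]; first exact: coord_continuous.
split=> [x _|]; first by have [] := is_derive_coord x (delta_mx ord0 i) j.
rewrite (_ : partial i _ = fun=> (delta_mx ord0 i : 'rV[R]_m) ord0 j).
  exact: Ck_cst.
by apply/funext => x; have [_ <-] := is_derive_coord x (delta_mx ord0 i) j.
Qed.

End Ck.

Section Norm.
Context (R : realType) (m : nat).
Implicit Types (x : 'rV[R]_m).

Lemma sumsq_gt0 x : x != 0 -> 0 < \sum_(i < m) x ord0 i ^+ 2.
Proof.
move=> x0; rewrite lt_def sumr_ge0 ?andbT => [|i _]; last exact: sqr_ge0.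
apply: contraNneq x0 => /eqP; rewrite psumr_eq0 => [|i _]; last exact: sqr_ge0.
move=> /allP x0; apply/eqP/rowP => i; rewrite mxE.
by apply/eqP; rewrite -sqrf_eq0; apply: (implyP (x0 i (mem_index_enum i))).
Qed.

Lemma enorm_gt0 x : x != 0 -> 0 < enorm x.
Proof. by move=> /sumsq_gt0; rewrite sqrtr_gt0. Qed.

Lemma enormZ (c : R) x : 0 <= c -> enorm (c *: x) = c * enorm x.
Proof.
move=> c0; rewrite /enorm; under eq_bigr do rewrite mxE exprMn.
by rewrite -mulr_sumr sqrtrM ?sqr_ge0 // sqrtr_sqr ger0_norm.
Qed.

Lemma is_derive_enorm x (v : 'rV[R]_m) : x != 0 ->
  is_derive x v (@enorm R m) ((enorm x)^-1 * \sum_(i < m) x ord0 i * v ord0 i).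
Proof.
move=> x0; apply/is_derive_line.
pose q (h : R) := \sum_(i < m) (h *: v + x) ord0 i ^+ 2.
have q0 : q 0 = \sum_(i < m) x ord0 i ^+ 2.
  by rewrite /q scale0r add0r.
have q_gt0 : 0 < q 0 by rewrite q0 sumsq_gt0.
have dq : is_derive (0 : R) 1 q (2 * \sum_(i < m) x ord0 i * v ord0 i).
  have dc i : is_derive (0 : R) 1 (fun h => (h *: v + x) ord0 i) (v ord0 i).
    by apply/(is_derive_line (fun y : 'rV_m => y ord0 i)); exact: is_derive_coord.
  rewrite (_ : q = \sum_(i < m) (fun h => (h *: v + x) ord0 i) ^+ 2).
    apply: is_derive_eq; rewrite mulr_sumr; apply: eq_bigr => i _.
    by rewrite scale0r add0r expr1 mulrA.
  by apply/funext => h; rewrite /q fct_sumE.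
have := is_derive1_comp (is_derive1_sqrt q_gt0) dq.
rewrite q0 -/(enorm x) invfM (mulrC 2^-1) -mulrA mulKf ?pnatr_eq0 //.
Qed.

Lemma open_neq0 : open [set x : 'rV[R]_m | x != 0].
Proof.
rewrite (_ : mkset _ = ~` [set 0]).
  apply: closed_openC; apply: accessible_closed_set1; apply: hausdorff_accessible.
  exact: norm_hausdorff.
by apply/seteqP; split=> x /eqP.
Qed.

Lemma Ck_sumsq k U : open U ->
  Ck k U (\sum_(i < m) (fun x : 'rV[R]_m => x ord0 i) ^+ 2).
Proof.
by move=> oU; apply: Ck_sum => // i _; apply: CkX => //; exact: Ck_coord.
Qed.

Lemma enorm_continuous : continuous (@enorm R m).
Proof.
move=> x; rewrite (_ : @enorm R m =
    Num.sqrt \o \sum_(i < m) (fun x : 'rV[R]_m => x ord0 i) ^+ 2).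
  apply: continuous_comp; last exact: sqrt_continuous.
  exact: (Ck_continuous (Ck_sumsq 0 openT)).
by apply/funext => y; rewrite /enorm /= fct_sumE.
Qed.

(** By induction on the order, from the formula d_i (1 / |x|) = - x_i (1 / |x|)^3,
    whose right-hand side is a product of functions already known to be regular. *)
Lemma Ck_enormV k : Ck k [set x : 'rV[R]_m | x != 0] (fun x => (enorm x)^-1).
Proof.
have cV x : x != 0 -> {for x, continuous (fun x : 'rV[R]_m => (enorm x)^-1)}.
  move=> x0; apply: continuousV; last exact: enorm_continuous.
  by rewrite gt_eqF ?enorm_gt0.
elim: k => [|k IHk]; first by split.
have dV x i : x != 0 -> is_derive x (delta_mx ord0 i)
    (fun x : 'rV[R]_m => (enorm x)^-1) (- (x ord0 i * (enorm x)^-1 ^+ 3)).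
  move=> x0.
  have := is_derive_enorm (delta_mx ord0 i) x0.
  rewrite (bigD1 i) //= big1 ?addr0 => [|j ji]; last first.
    by rewrite mxE (negPf ji) andbF mulr0.
  rewrite mxE !eqxx mulr1 => dr.
  have rx0 : enorm x != 0 by rewrite gt_eqF ?enorm_gt0.
  have [dV eV] : is_derive x (delta_mx ord0 i) (fun y : 'rV_m => (enorm y)^-1)
      (- enorm x ^- 2 *: ((enorm x)^-1 * x ord0 i)).
    case: dr => dr er; constructor; first exact: derivableV.
    by rewrite deriveV // er.
  constructor; rewrite // eV.
  by rewrite scaleNr /GRing.scale /= !exprS expr0; field.
split=> // i; split=> [x x0|]; first by have [] := dV x i x0.
apply: (Ck_congr (F := cst (-1) *
  ((fun x => x ord0 i) * (fun x => (enorm x)^-1) ^+ 3))).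
- exact: open_neq0.
- by move=> x x0; rewrite /partial; have [_ ->] := dV x i x0; rewrite mulN1r.
- have oU := open_neq0.
  apply: CkM => //; first exact: Ck_cst.
  by apply: CkM => //; [exact: Ck_coord|exact: CkX].
Qed.

(** |x| = |x|^2 (1 / |x|), with |x|^2 a polynomial. *)
Lemma Ck_enorm k : Ck k [set x : 'rV[R]_m | x != 0] (@enorm R m).
Proof.
have oU := open_neq0.
apply: (Ck_congr (F := (\sum_(i < m) (fun x : 'rV[R]_m => x ord0 i) ^+ 2)
                        * (fun x => (enorm x)^-1))) => //.
  move=> x x0 /=.
  rewrite -[LHS]/(_ * _) fct_sumE -(sqr_sqrtr (ltW (sumsq_gt0 x0))) -/(enorm x).
  by rewrite expr2 mulfK // gt_eqF ?enorm_gt0.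
by apply: CkM => //; [exact: Ck_sumsq|exact: Ck_enormV].
Qed.
End Norm.

Section Sphere.
Context (R : realType) (n : nat).
Implicit Types (f g : sphere R n -> R) (x : 'rV[R]_n.+1).

Lemma radial_extE x : x != 0 ->
  exists p : sphere R n, val p = (enorm x)^-1 *: x /\
    forall f, radial_ext f x = f p.
Proof.
move=> x0; have r0 := enorm_gt0 x0.
have u1 : enorm ((enorm x)^-1 *: x) == 1.
  by rewrite enormZ ?invr_ge0 ?ltW // mulVf // gt_eqF.
exists (exist (fun x : 'rV[R]_n.+1 => enorm x == 1) _ u1); split=> // f.
by rewrite /radial_ext (insubT (fun x : 'rV[R]_n.+1 => enorm x == 1) u1).
Qed.

Lemma radial_extZ f (c : R) x : 0 < c -> radial_ext f (c *: x) = radial_ext f x.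
Proof.
move=> c0; rewrite /radial_ext enormZ ?ltW // scalerA invfM.
by rewrite mulrAC mulVf ?mul1r // gt_eqF.
Qed.

Lemma radial_extD f g : radial_ext (f + g) = radial_ext f + radial_ext g.
Proof.
apply/funext => x; rewrite /radial_ext /GRing.add /=.
by case: insubP => //= _; rewrite addr0.
Qed.

Lemma radial_extMl (c : R) f : radial_ext (c *: f) = cst c * radial_ext f.
Proof.
apply/funext => x; rewrite /radial_ext /GRing.scale /GRing.mul /=.
by case: insubP => //= _; rewrite mulr0.
Qed.

(** A function that is homogeneous of degree 0 has partial derivatives that are
    homogeneous of degree - 1. *)
Lemma partial_radialZ f i (c : R) x : 0 < c ->
  derivable (radial_ext f) x (delta_mx ord0 i) ->
  partial i (radial_ext f) (c *: x) = c^-1 * partial i (radial_ext f) x.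
Proof.
move=> c0 /derivableP/is_derive_line dx.
have cV0 : (0 : R) * c^-1 = 0 by rewrite mul0r.
rewrite -{1}cV0 in dx.
have dc : is_derive (0 : R) 1 (fun h : R => h * c^-1) c^-1.
  rewrite (_ : (fun h => _) = c^-1 \*: id); last first.
    by apply/funext => h /=; rewrite mulrC.
  by apply: is_derive_eq; rewrite [_%:A]mulr1.
have := is_derive1_comp (g := fun h : R => h * c^-1) dx dc.
rewrite mulrC (_ : _ \o _ =
    fun h : R => radial_ext f (h *: delta_mx ord0 i + c *: x)).
  by move=> /(is_derive_line (radial_ext f)) [_ <-].
apply/funext => h /=; rewrite -[in RHS](radial_extZ f (c := c^-1)) ?invr_gt0 //.
by rewrite scalerDr !scalerA mulVf ?scale1r ?gt_eqF // mulrC.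
Qed.

(** Restricting the derivative to the sphere and extending it radially turns
    degree - 1 into degree 0, which costs the factor |x|.  This is what makes the
    smoothness of |x| enter. *)
Lemma radial_ext_tangential f i x : x != 0 ->
  derivable (radial_ext f) x (delta_mx ord0 i) ->
  radial_ext (tangential_derivative i f) x =
  enorm x * partial i (radial_ext f) x.
Proof.
move=> x0 dx; have [p [pE ->]] := radial_extE x0.
rewrite /tangential_derivative pE partial_radialZ ?invrK //.
by rewrite invr_gt0 enorm_gt0.
Qed.

Lemma sphere_neq0 (p : sphere R n) : val p != 0.
Proof.
apply/eqP => p0; have /eqP := valP p; rewrite p0 -(scale0r 0) enormZ // mul0r.
by move=> /eqP; rewrite eq_sym oner_eq0.
Qed.

Lemma smooth_derivable f i x : smooth f -> x != 0 ->
  derivable (radial_ext f) x (delta_mx ord0 i).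
Proof. by move=> sf x0; apply: (Ck_derivable (sf 1)). Qed.

Lemma smoothD f g : smooth f -> smooth g -> smooth (f + g).
Proof.
by move=> sf sg k; rewrite radial_extD; apply: CkD => //; exact: open_neq0.
Qed.

Lemma smoothZ (c : R) f : smooth f -> smooth (c *: f).
Proof.
move=> sf k; rewrite radial_extMl; apply: CkM => //; [exact: open_neq0|exact: Ck_cst].
Qed.

Lemma smooth0 : smooth (0 : sphere R n -> R).
Proof.
move=> k; rewrite (_ : radial_ext _ = fun=> 0); first exact: Ck_cst.
by apply/funext => x; rewrite /radial_ext; case: insub.
Qed.

Lemma smooth_tangential f i : smooth f -> smooth (tangential_derivative i f).
Proof.
move=> sf k; have oU := @open_neq0 R n.+1.
apply: (Ck_congr (F := @enorm R n.+1 * partial i (radial_ext f))) => //.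
  by move=> x x0; rewrite radial_ext_tangential //; exact: smooth_derivable.
apply: CkM => //; first exact: Ck_enorm.
by apply: Ck_partial; exact: (sf k.+1).
Qed.

Lemma tangentialD f g i : smooth f -> smooth g ->
  tangential_derivative i (f + g) =
  tangential_derivative i f + tangential_derivative i g.
Proof.
move=> sf sg; apply/funext => p; rewrite /tangential_derivative radial_extD.
by rewrite /partial deriveD //; apply: smooth_derivable => //; exact: sphere_neq0.
Qed.

Lemma tangentialZ (c : R) f i : smooth f ->
  tangential_derivative i (c *: f) = c *: tangential_derivative i f.
Proof.
move=> sf; apply/funext => p; rewrite /tangential_derivative radial_extMl.
rewrite /partial deriveM ?derive_cst ?scaler0 ?addr0 //.
by apply: smooth_derivable => //; exact: sphere_neq0.
Qed.

Lemma laplacianE f :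
  laplacian f = \sum_i tangential_derivative i (tangential_derivative i f).
Proof. by apply/funext => p; rewrite fct_sumE. Qed.

Lemma smooth_laplacian f : smooth f -> smooth (laplacian f).
Proof.
move=> sf; rewrite laplacianE.
elim/big_ind: _ => [|g h|i _]; [exact: smooth0|exact: smoothD|].
by do 2!apply: smooth_tangential.
Qed.

Lemma laplacianD f g : smooth f -> smooth g ->
  laplacian (f + g) = laplacian f + laplacian g.
Proof.
move=> sf sg; rewrite !laplacianE -big_split; apply: eq_bigr => i _ /=.
by rewrite -tangentialD -?tangentialD //; exact: smooth_tangential.
Qed.

Lemma laplacianZ (c : R) f : smooth f -> laplacian (c *: f) = c *: laplacian f.
Proof.
move=> sf; rewrite !laplacianE scaler_sumr; apply: eq_bigr => i _.
by rewrite -tangentialZ -?tangentialZ //; exact: smooth_tangential.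
Qed.

End Sphere.

(** * Alternating binomial sums *)

Section AlternatingSums.
Context (F : numFieldType).
Implicit Types (f : nat -> F).

(** Up to the sign [(-1) ^+ m], the [m]-th finite difference of [f] at 0. *)
Definition altsum f (m : nat) : F :=
  \sum_(i < m.+1) (-1) ^+ i * 'C(m, i)%:R * f i.

Lemma altsum_widen f m K : (m < K)%N ->
  altsum f m = \sum_(i < K) (-1) ^+ i * 'C(m, i)%:R * f i.
Proof.
move=> mK; rewrite /altsum.
rewrite (big_ord_widen K (fun i => (-1) ^+ i * 'C(m, i)%:R * f i)) //.
rewrite big_mkcond; apply: eq_bigr => i _; case: ifP => // /negbT.
by rewrite -leqNgt => mi; rewrite bin_small // mulr0 mul0r.
Qed.

Lemma altsumS f m : altsum f m.+1 = altsum f m - altsum (f \o succn) m.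
Proof.
rewrite (@altsum_widen f m m.+2) // /altsum big_ord_recl.
rewrite [X in _ = X - _]big_ord_recl /= !bin0 -addrA.
congr (_ + _); rewrite -sumrB; apply: eq_bigr => i _ /=.
by rewrite /bump /= add1n binS natrD exprS; ring.
Qed.

Lemma altsum_const (c : F) m : altsum (fun=> c) m = if m is 0 then c else 0.
Proof.
case: m => [|m]; last by rewrite altsumS subrr.
by rewrite /altsum big_ord1 bin0 !mul1r.
Qed.

(** Expansion of 1 / ((k+1) ... (k+m+1)) in simple fractions. *)
Lemma altsum_inv (k m : nat) :
  altsum (fun l => ((k + l.+1)%:R)^-1) m = (m`! * k`!)%:R / (k + m.+1)`!%:R.
Proof.
have fact_neq0 j : (j`!)%:R != 0 :> F by rewrite pnatr_eq0 -lt0n fact_gt0.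
elim: m k => [|m IHm] k.
  rewrite /altsum big_ord1 bin0 !mul1r fact0 mul1n addn1 factS natrM.
  by rewrite invfM mulrCA mulfV ?mulr1.
rewrite altsumS IHm.
rewrite (_ : altsum _ m = altsum (fun l => ((k.+1 + l.+1)%:R)^-1) m); last first.
  by apply: eq_bigr => i _ /=; rewrite addSnnS.
rewrite IHm addSn !addnS !factS !natrM.
have := fact_neq0 (k + m)%N.
have n0 j : (j.+1)%:R != 0 :> F by rewrite pnatr_eq0.
move=> h; move: (n0 (k + m)%N) (n0 (k + m).+1); rewrite -!natr1 !natrD => h1 h2.
by field; rewrite h h1 h2.
Qed.

End AlternatingSums.

(** * Frobenius solutions of theta (theta + kap) y = - x z / (1 - z)^2 y *)

Section ThreeTerm.
Context (F : numFieldType) (x : F).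
Implicit Types (kap : F) (q b w : nat -> F).

(** Comparison of the coefficients of z^(n+2) in
    (1 - z)^2 theta (theta + kap) y = - x z y, for y the sum of the b_n z^n. *)
Definition three_term kap b (n : nat) : Prop :=
  (n%:R + 2) * (n%:R + 2 + kap) * b n.+2
  - 2 * (n%:R + 1) * (n%:R + 1 + kap) * b n.+1
  + n%:R * (n%:R + kap) * b n + x * b n.+1 = 0.

(** The contribution of a single [q i] to [altsum_three_term], apart from the
    term in [x]: it is again a multiple of one binomial coefficient, so that the
    whole sum telescopes. *)
Lemma binomial_second_difference kap (m i : nat) :
  (m%:R + 3) * (m%:R + 3 + kap) * 'C(m.+2, i)%:R
  - 2 * (m%:R + 2) * (m%:R + 2 + kap) * 'C(m.+1, i)%:R
  + (m%:R + 1) * (m%:R + 1 + kap) * 'C(m, i)%:R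
  - (i%:R + 1) * (i%:R + 2) * 'C(m.+1, i)%:R
  = if i is j.+1 then (j%:R + 2) * (kap + j%:R + 2) * 'C(m.+1, j)%:R else 0 :> F.
Proof.
case: i => [|j]; first by rewrite !bin0; ring.
have left : (j%:R + 1) * 'C(m.+1, j.+1)%:R
            = (m%:R + 1 - j%:R) * 'C(m.+1, j)%:R :> F.
  have [jm|mj] := leqP j m.+1; last by rewrite !bin_small ?mulr0 // ltnW.
  rewrite !natr1 -natrB // -!natrM.
  by rewrite mul_bin_left.
have down : (m%:R + 1) * 'C(m, j.+1)%:R = (m%:R - j%:R) * 'C(m.+1, j.+1)%:R :> F.
  have [jm|mj] := leqP j m; last by rewrite !bin_small ?mulr0 // ltnW.
  by rewrite natr1 -natrB // -!natrM mul_bin_down subSS.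
rewrite binS natrD -natr1.
apply/eqP; rewrite -subr_eq0; apply/eqP.
(* The difference is a combination of the relations [down] and [left]. *)
transitivity ((m%:R + 1 + kap) *
    ((m%:R + 1) * 'C(m, j.+1)%:R - (m%:R - j%:R) * 'C(m.+1, j.+1)%:R)
  + (m%:R + j%:R + 5 + kap) *
    ((m%:R + 1 - j%:R) * 'C(m.+1, j)%:R - (j%:R + 1) * 'C(m.+1, j.+1)%:R)); first ring.
by rewrite left down !subrr !mulr0 addr0.
Qed.

(** The hypothesis is the two-term recursion of a hypergeometric series in the
    variable - z / (1 - z), with coefficients [q i]; binomial sums express the change
    of variable on coefficients. *)
Lemma altsum_three_term kap q (m : nat) :
  (forall i, x * q i =
     (i%:R + 2) * ((kap + i%:R + 2) * q i.+1 - (i%:R + 1) * q i)) ->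
  (m%:R + 3) * (m%:R + 3 + kap) * altsum q m.+2
  - 2 * (m%:R + 2) * (m%:R + 2 + kap) * altsum q m.+1
  + (m%:R + 1) * (m%:R + 1 + kap) * altsum q m + x * altsum q m.+1 = 0.
Proof.
move=> xq.
rewrite (@altsum_widen _ q m m.+3)
  ?(@altsum_widen _ q m.+1 m.+3) //; last exact: leqW.
rewrite /altsum !mulr_sumr -sumrN -!big_split /=.
(* [t i] is what the [x]-term of index [i - 1] contributes to [q i]. *)
pose t i : F := if i is j.+1 then
  (-1) ^+ j * 'C(m.+1, j)%:R * ((j%:R + 2) * (kap + j%:R + 2) * q j.+1) else 0.
rewrite (eq_bigr (fun i : 'I_m.+3 => t i.+1 - t i)) => [|i _]; last first.
  rewrite /t (mulrCA x) xq.
  have := binomial_second_difference kap m i.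
  case: (nat_of_ord i) => [|j] E.
    by rewrite !bin0; ring.
  transitivity ((-1) ^+ j.+1 * ('C(m.+1, j.+1)%:R *
      ((j.+1%:R + 2) * ((kap + j.+1%:R + 2) * q j.+2)) +
   ((m%:R + 3) * (m%:R + 3 + kap) * 'C(m.+2, j.+1)%:R
  - 2 * (m%:R + 2) * (m%:R + 2 + kap) * 'C(m.+1, j.+1)%:R
  + (m%:R + 1) * (m%:R + 1 + kap) * 'C(m, j.+1)%:R
  - (j.+1%:R + 1) * (j.+1%:R + 2) * 'C(m.+1, j.+1)%:R) * q j.+1)); first ring.
  by rewrite E exprS; ring.
rewrite -(big_mkord xpredT (fun i => t i.+1 - t i)) telescope_sumr // subr0 /t.
by rewrite bin_small // mulr0 mul0r.
Qed.

Definition gjms_value (j : nat) : F := \prod_(k < j) (x + (k * k.+1)%:R).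

Lemma gjms_valueS j : gjms_value j.+1 = gjms_value j * (x + (j * j.+1)%:R).
Proof. exact: big_ord_recr. Qed.

(** The coefficient of z^M in
    sum_j p_j w_j / j! (- z / (1 - z))^j, since the coefficient of z^M in
    (z / (1 - z))^j is the binomial coefficient 'C(M - 1, j - 1).  The sequence
    [w] is left free because two choices of it are needed, one for each exponent
    of the equation. *)
Definition frobenius w (M : nat) : F :=
  if M is m.+1 then
    - altsum (fun i => gjms_value i.+1 * w i.+1 / (i.+1)`!%:R) m
  else w 0%N.

(** The equation only constrains the ratios of consecutive weights, and in a form
    that allows [kap] to be a negative integer. *)
Lemma frobenius_three_term kap w :
  (forall j, w j = (kap + j%:R + 1) * w j.+1) ->
  forall n, three_term kap (frobenius w) n.
Proof.
move=> wS n; rewrite /three_term.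
pose q i := gjms_value i.+1 * w i.+1 / (i.+1)`!%:R.
have fact_neq0 j : (j`!)%:R != 0 :> F by rewrite pnatr_eq0 -lt0n fact_gt0.
have xq i : x * q i =
     (i%:R + 2) * ((kap + i%:R + 2) * q i.+1 - (i%:R + 1) * q i).
  rewrite /q (gjms_valueS i.+1) (wS i.+1) (factS i.+1) !natrM -!natr1.
  field; rewrite fact_neq0 /=.
  by rewrite !natr1 !pnatr_eq0.
case: n => [|m] /=.
  rewrite -/q /altsum !big_ord_recl !big_ord0 /bump /= !bin0 bin1.
  have := xq 0%N.
  transitivity (- (x * q 0%N) + 2 * ((kap + 2) * q 1%N - q 0%N)); first ring.
  by rewrite xq; ring.
have := altsum_three_term m xq; rewrite -/q -natr1 => E.
rewrite -[RHS]oppr0 -E; ring.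
Qed.

Lemma frobenius1 kap w : (forall j, w j = (kap + j%:R + 1) * w j.+1) ->
  (1 + kap) * frobenius w 1 = - x * frobenius w 0.
Proof.
move=> wS; rewrite /frobenius /altsum big_ord1 (wS 0%N) gjms_valueS /gjms_value.
by rewrite big_ord0 bin0 (factS 0) fact0 /= expr0 mul0n; field.
Qed.

(** When [- kap] is not a positive integer, the leading coefficient of the
    recursion never vanishes, so its solutions are determined by [b 0]. *)
Lemma three_term_unique kap b c :
  (forall n, n%:R + 1 + kap != 0) ->
  (1 + kap) * b 1%N = - x * b 0%N -> (forall n, three_term kap b n) ->
  (1 + kap) * c 1%N = - x * c 0%N -> (forall n, three_term kap c n) ->
  forall n, b n * c 0%N = b 0%N * c n.
Proof.
move=> kap0 b1 bS c1 cS n.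
suff [] : b n * c 0%N = b 0%N * c n /\ b n.+1 * c 0%N = b 0%N * c n.+1 by [].
elim: n => [|n [IH0 IH1]]; split=> //.
  have k0 := kap0 0%N; rewrite add0r in k0; apply: (mulfI k0).
  by rewrite mulrA b1 mulrCA c1; ring.
have n2 : n%:R + 2 != 0 :> F by rewrite -natrD pnatr_eq0 addn2.
have k2 : n%:R + 2 + kap != 0.
  rewrite (_ : _ + kap = n.+1%:R + 1 + kap) //.
  by rewrite -natr1; ring.
apply: (mulfI (mulf_neq0 n2 k2)).
have bn := bS n; have cn := cS n; rewrite /three_term in bn cn.
apply/eqP; rewrite -subr_eq0; apply/eqP.
transitivity (
  ((n%:R + 2) * (n%:R + 2 + kap) * b n.+2
  - 2 * (n%:R + 1) * (n%:R + 1 + kap) * b n.+1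
  + n%:R * (n%:R + kap) * b n + x * b n.+1) * c 0%N
 - b 0%N * ((n%:R + 2) * (n%:R + 2 + kap) * c n.+2
  - 2 * (n%:R + 1) * (n%:R + 1 + kap) * c n.+1
  + n%:R * (n%:R + kap) * c n + x * c n.+1)
 + (2 * (n%:R + 1) * (n%:R + 1 + kap) - x) * (b n.+1 * c 0%N - b 0%N * c n.+1)
 - n%:R * (n%:R + kap) * (b n * c 0%N - b 0%N * c n)); first ring.
by rewrite bn cn IH0 IH1 !subrr !(mulr0, mul0r) !subr0 addr0.
Qed.

End ThreeTerm.

(** * Simple fractions of the regular solution *)

Section Frobenius.
Context (F : numFieldType) (x : F).

(** 1 / ((k+1) ... (k+j)), the weight for the exponent 0 of [kap = k]. *)
Definition rising_weight (k j : nat) : F := k`!%:R / (k + j)`!%:R.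

(** The weight for the exponent [l] of [kap = - l], where the product
    (kap+1) ... (kap+j) vanishes as soon as [j >= l]. *)
Definition resonant_weight (l j : nat) : F :=
  if (l <= j)%N then ((j - l)`!%:R)^-1 else 0.

Let fact_neq0 j : (j`!)%:R != 0 :> F.
Proof. by rewrite pnatr_eq0 -lt0n fact_gt0. Qed.

Lemma rising_weight0 k : rising_weight k 0 = 1.
Proof. by rewrite /rising_weight addn0 divff. Qed.

Lemma rising_weightS k j :
  rising_weight k j = (k%:R + j%:R + 1) * rising_weight k j.+1.
Proof.
rewrite /rising_weight addnS factS natrM -natr1 natrD.
by field; rewrite fact_neq0 -natrD natr1 pnatr_eq0.
Qed.

Lemma resonant_weightS l j :
  resonant_weight l j = (- l%:R + j%:R + 1) * resonant_weight l j.+1.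
Proof.
rewrite /resonant_weight; case: (ltngtP l j) => [lj|jl|->].
- rewrite leqW ?(ltnW lj) // subSn ?(ltnW lj) // factS natrM -natr1.
  rewrite natrB ?(ltnW lj) //.
  field; rewrite fact_neq0 -natrB ?(ltnW lj) // natr1 pnatr_eq0.
  done.
- case: (ltngtP l j.+1) jl => // [|-> _]; first by rewrite mulr0.
  by rewrite -natr1; ring.
- by rewrite leqnSn subnn subSnn fact0 invr1 mulr1 addNr add0r.
Qed.

Definition frob (k : nat) := frobenius x (rising_weight k).

Lemma frob0 k : frob k 0 = 1.
Proof. exact: rising_weight0. Qed.

Lemma frobenius_resonant0 l M : (M < l)%N ->
  frobenius x (resonant_weight l) M = 0.
Proof.
case: M => [|m] ml /=; first by rewrite /resonant_weight leqNgt ml.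
rewrite /altsum big1 ?oppr0 // => i _.
have li : (l <= i.+1)%N = false.
  by apply/negbTE; rewrite -ltnNge; apply: leq_trans ml; rewrite !ltnS -ltnS.
by rewrite /resonant_weight li mulr0 mul0r mulr0.
Qed.

Lemma frobenius_resonant_leading l :
  frobenius x (resonant_weight l.+1) l.+1 =
  (-1) ^+ l.+1 * gjms_value x l.+1 / (l.+1)`!%:R.
Proof.
rewrite /= /altsum big_ord_recr big1 /= => [|i _].
  rewrite binn /resonant_weight leqnn subnn fact0 invr1 !mulr1.
  by rewrite exprS add0r mulN1r !mulNr mulrA.
by rewrite /resonant_weight ltnS leqNgt ltn_ord /= mulr0 mul0r mulr0.
Qed.

(** For [kap = - l] the solution of exponent [l] is, after division by z^l, a
    regular solution for [kap = l]: the factors M (M - l) of the recursion become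
    m (m + l) for M = l + m.  Both sides obey the recursion for [kap = l] and
    agree at [m = 0]. *)
Lemma frobenius_resonance l m :
  frobenius x (resonant_weight l.+1) (l.+1 + m) =
  (-1) ^+ l.+1 * gjms_value x l.+1 / (l.+1)`!%:R * frob l.+1 m.
Proof.
pose b m := frobenius x (resonant_weight l.+1) (l.+1 + m).
have bS := frobenius_three_term x (resonant_weightS l.+1).
have cS := frobenius_three_term x (rising_weightS l.+1).
have b0 : b 0%N = (-1) ^+ l.+1 * gjms_value x l.+1 / (l.+1)`!%:R.
  by rewrite /b addn0 frobenius_resonant_leading.
rewrite -b0 -/(b m) -[b m]mulr1 -(frob0 l.+1).
apply: (@three_term_unique _ x l.+1%:R).
- by move=> n; rewrite natr1 -natrD pnatr_eq0.
- (* The recursion one step below the exponent, where the previous coefficient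
     of the solution is 0. *)
  have := bS l; rewrite /b /three_term addn1 addn0.
  case: l {b b0 bS cS} => [|l] E; last first.
    rewrite (@frobenius_resonant0 l.+2 l.+1) // in E.
    apply/eqP; rewrite -subr_eq0; apply/eqP; rewrite -E -!natr1; ring.
  apply/eqP; rewrite -subr_eq0; apply/eqP; rewrite -E; ring.
- move=> n; have := bS (l.+1 + n)%N; rewrite /b /three_term !addnS natrD => E.
  by rewrite -E; ring.
- exact: (frobenius1 x (rising_weightS l.+1)).
- exact: cS.
Qed.

Definition normalized_gjms (l : nat) : F := gjms_value x l / (l`! * l.-1`!)%:R.

(** The numbers [- normalized_gjms l * frob l (M - l)] are the residues of
    [frob k M] at [k = - l]; by [frobenius_resonance] they are binomial sums, and
    exchanging the sums leaves an alternating sum of the test function [phi]. *)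
Lemma sum_normalized_gjms_frob (phi : nat -> F) M :
  \sum_(l < M) normalized_gjms l.+1 * frob l.+1 (M - l.+1) * phi l =
  \sum_(i < M) (-1) ^+ i * 'C(M.-1, i)%:R *
    (gjms_value x i.+1 / ((i.+1)`! * i`!)%:R) * altsum phi i.
Proof.
transitivity (\sum_(l < M) \sum_(i < M) (-1) ^+ i * 'C(M.-1, i)%:R *
    (gjms_value x i.+1 / ((i.+1)`! * i`!)%:R) *
    ((-1) ^+ l * 'C(i, l)%:R * phi l)).
  apply: eq_bigr => l _.
  under eq_bigr do rewrite !mulrA.
  rewrite -mulr_suml; congr (_ * _).
  have lM : (l < M)%N := ltn_ord l.
  have := frobenius_resonance l (M - l.+1); rewrite subnKC // => E.
  transitivity ((-1) ^+ l.+1 / l`!%:R * frobenius x (resonant_weight l.+1) M).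
    rewrite E /normalized_gjms natrM /=.
    have ss : (-1) ^+ l.+1 * (-1) ^+ l.+1 = 1 :> F by rewrite -expr2 sqrr_sign.
    move: ((-1) ^+ l.+1 : F) ss => s ss; rewrite -[LHS]mul1r -{1}ss.
    move: (fact_neq0 l) (fact_neq0 l.+1) => h0 h1.
    by field; rewrite h0 h1.
  move: {E}(nat_of_ord l) lM => {}l.
  case: M => // M lM; rewrite /= /altsum mulrN -mulNr mulr_sumr.
  apply: eq_bigr => i _; rewrite /resonant_weight ltnS.
  case: leqP => li; last by rewrite (@bin_small i l) // !(mulr0, mul0r).
  have -> : 'C(i, l)%:R = i`!%:R / (l`!%:R * (i - l)`!%:R) :> F.
    by rewrite -(bin_fact li) !natrM mulfK // mulf_neq0.
  rewrite subSS natrM exprS.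
  move: (fact_neq0 i.+1) (fact_neq0 i) (fact_neq0 l) (fact_neq0 (i - l)%N).
  move: ((i.+1)`!%:R : F) (i`!%:R : F) (l`!%:R : F) ((i - l)`!%:R : F).
  by move=> fi1 fi fl fil h1 h2 h3 h4; field; rewrite h1 h2 h3 h4.
rewrite exchange_big; apply: eq_bigr => i _ /=.
by rewrite -mulr_sumr (@altsum_widen _ _ _ M).
Qed.

(** With [phi = 1] the inner alternating sum vanishes except for [i = 0]. *)
Lemma sum_normalized_gjms_frob1 M : (0 < M)%N ->
  \sum_(l < M) normalized_gjms l.+1 * frob l.+1 (M - l.+1) = x.
Proof.
case: M => // M _.
have := sum_normalized_gjms_frob (fun=> 1) M.+1.
under eq_bigr do rewrite mulr1.
move=> ->; rewrite big_ord_recl big1 => [|i _].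
  by rewrite altsum_const bin0 /gjms_value big_ord1 !mul1r mulr1 addr0 divr1 addr0.
by rewrite altsum_const mulr0.
Qed.

Lemma frob_partial_fractions k M : (0 < M)%N ->
  frob k M = - \sum_(l < M) normalized_gjms l.+1 * frob l.+1 (M - l.+1)
                 / (k + l.+1)%:R.
Proof.
case: M => // M _; rewrite (sum_normalized_gjms_frob (fun l => (k + l.+1)%:R^-1)).
congr (- _); apply: eq_bigr => i _; rewrite altsum_inv /rising_weight !natrM -!mulrA.
congr (_ * (_ * (_ * _))).
move: (fact_neq0 i.+1) (fact_neq0 i) (fact_neq0 (k + i.+1)%N).
move: ((i.+1)`!%:R : F) (i`!%:R : F) ((k + i.+1)`!%:R : F) => a b c h1 h2 h3.
by field; rewrite h2 h3 addrC natr1 pnatr_eq0.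
Qed.

End Frobenius.

(** * Sums over compositions *)

Section CompositionSums.
Context (F : numFieldType) (x : F).

Lemma big_tuple_cons (V : nmodType) (T : finType) (r : nat) (P : pred (seq T))
    (G : seq T -> V) :
  \sum_(t : r.+1.-tuple T | P t) G t =
  \sum_(i : T) \sum_(t : r.-tuple T | P (i :: t)) G (i :: t).
Proof.
rewrite pair_big_dep /=.
rewrite (reindex (fun p : T * r.-tuple T => [tuple of p.1 :: p.2])) //=.
exists (fun t : r.+1.-tuple T => (thead t, [tuple of behead t])) => [[i t]|t] _ /=.
  by congr (_, _); apply/val_inj.
by rewrite -tuple_eta.
Qed.

(** The first argument is the part that precedes [I] in a longer composition; it
    enters only through the denominator of the first factor. *)
Fixpoint chain_weight (k : nat) (I : seq nat) : F :=
  if I is i :: I' then - (normalized_gjms x i / (k + i)%:R) * chain_weight i I'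
  else 1.

Lemma sum_ord_positive (V : nmodType) (K M : nat) (G : nat -> V) : (M < K)%N ->
  \sum_(l < K | (0 < l <= M)%N) G l = \sum_(l < M) G l.+1.
Proof.
case: K => // K MK; rewrite big_mkcond big_ord_recl /= add0r -big_mkcond /=.
rewrite (big_ord_widen_cond K xpredT (fun l => G l.+1)) //.
Qed.

Lemma is_composition_cons N i I :
  is_composition N (i :: I) = (0 < i <= N)%N && is_composition (N - i) I.
Proof.
rewrite /is_composition /= -!andbA; case: (0 < i)%N => //=.
case: (all _ _); rewrite ?andbF //=.
case: leqP => iN /=; last by apply/eqP; lia.
by apply/eqP/eqP; lia.
Qed.

Lemma big_tuple0 (V : nmodType) (T : finType) (P : pred (seq T)) (G : seq T -> V) :
  \sum_(t : 0.-tuple T | P t) G t = if P [::] then G [::] else 0.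
Proof.
rewrite big_mkcond (bigD1 [tuple]) //= big1 ?addr0 // => t.
by move=> /eqP[]; exact: tuple0.
Qed.

(** The index types bound lengths and parts by unrelated [R] and [K], so that the
    tail of a composition ranges over the same types as the composition itself. *)
Lemma sum_composition_cons (V : nmodType) (R K M : nat) (G : seq nat -> V) :
  (M < K)%N ->
  \sum_(r < R) \sum_(I : r.+1.-tuple 'I_K | is_composition M (map val I))
    G (map val I) =
  \sum_(l < M) \sum_(r < R)
    \sum_(I : r.-tuple 'I_K | is_composition (M - l.+1) (map val I))
      G (l.+1 :: map val I).
Proof.
move=> MK; rewrite -(sum_ord_positive (fun l => \sum_(r < R)
    \sum_(I : r.-tuple 'I_K | is_composition (M - l) (map val I))
      G (l :: map val I)) MK).
rewrite [RHS]exchange_big; apply: eq_bigr => r _ /=.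
rewrite (big_tuple_cons r (fun s : seq 'I_K => is_composition M (map val s))
  (fun s => G (map val s))) [RHS]big_mkcond; apply: eq_bigr => l _.
transitivity (\sum_(I : r.-tuple 'I_K |
    (0 < l <= M)%N && is_composition (M - l) (map val I)) G (val l :: map val I)).
  by apply: eq_bigl => I; exact: (is_composition_cons M l (map val I)).
by case: ifP => _ //=; rewrite big_pred0.
Qed.

(** Splitting off the first part turns the sum into the expansion of [frob] in
    simple fractions. *)
Lemma sum_chain_weight (R K M k : nat) : (M <= R)%N -> (M < K)%N ->
  \sum_(r < R.+1) \sum_(I : r.-tuple 'I_K | is_composition M (map val I))
    chain_weight k (map val I) = frob x k M.
Proof.
elim: R M k => [|R IHR] M k MR MK; rewrite big_ord_recl.
  rewrite (big_tuple0 (fun s : seq 'I_K => is_composition M (map val s))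
    (fun s => chain_weight k (map val s))) big_ord0 addr0.
  by case: M MR {MK} => // _; rewrite frob0.
rewrite (big_tuple0 (fun s : seq 'I_K => is_composition M (map val s))
    (fun s => chain_weight k (map val s))).
rewrite (sum_composition_cons R.+1 (chain_weight k) MK) /=.
case: M MR MK => [|M] MR MK; first by rewrite big_ord0 addr0 frob0.
rewrite add0r frob_partial_fractions // -sumrN; apply: eq_bigr => l _.
under eq_bigr do rewrite -mulr_sumr.
rewrite -mulr_sumr IHR; [|lia..].
by rewrite mulNr mulrAC.
Qed.

Lemma sum_normalized_chain_weight (N K : nat) : (0 < N)%N -> (N < K)%N ->
  \sum_(r < N.+1) \sum_(I : r.-tuple 'I_K | is_composition N (map val I))
    (if map val I is i :: I' then normalized_gjms x i * chain_weight i I' else 0)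
  = x.
Proof.
move=> N0 NK; pose G (I : seq nat) :=
  if I is i :: I' then normalized_gjms x i * chain_weight i I' else 0.
rewrite big_ord_recl (big_tuple0 (fun s : seq 'I_K => is_composition N (map val s))
    (fun s => G (map val s))) /= if_same add0r.
rewrite (sum_composition_cons N G NK) -[RHS](sum_normalized_gjms_frob1 x N0).
apply: eq_bigr => l _; rewrite /G.
under eq_bigr do rewrite -mulr_sumr.
rewrite -mulr_sumr; congr (_ * _).
case: N N0 NK l => // N _ NK l.
by rewrite sum_chain_weight //; lia.
Qed.

Lemma chain_weightE i I :
  normalized_gjms x i * chain_weight i I =
  (-1) ^+ size I * \prod_(j <- i :: I) normalized_gjms x j
  * \prod_(j < size I) ((nth 0%N (i :: I) j + nth 0%N (i :: I) j.+1)%:R)^-1.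
Proof.
elim: I i => [|l I IHI] i; first by rewrite big_seq1 big_ord0 !mul1r.
rewrite /= big_cons big_ord_recl /= exprS.
transitivity (- (normalized_gjms x i / (i + l)%:R) *
    (normalized_gjms x l * chain_weight l I)).
  by ring.
rewrite IHI; ring.
Qed.

End CompositionSums.

Section JuhlCoefficients.
Context (R : realType) (x : R).

Lemma mcoef_gjms_value i I :
  mcoef R (i :: I) * \prod_(j <- i :: I) gjms_value x j =
  ((sumn (i :: I))`! * (sumn (i :: I)).-1`!)%:R
  * (normalized_gjms x i * chain_weight x i I).
Proof.
rewrite chain_weightE /mcoef /= -/(sumn (i :: I)) big_split /= exprS natrM.
ring.
Qed.

Lemma sum_mcoef_gjms_value N K : (0 < N)%N -> (N < K)%N ->
  \sum_(r < N.+1) \sum_(I : r.-tuple 'I_K | is_composition N (map val I))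
    mcoef R (map val I) * \prod_(j <- map val I) gjms_value x j
  = (N`! * N.-1`!)%:R * x.
Proof.
move=> N0 NK; rewrite -[X in _ * X](sum_normalized_chain_weight x N0 NK) mulr_sumr.
apply: eq_bigr => r _; rewrite mulr_sumr; apply: eq_bigr => I.
case: (map val I) => [|i {}I]; rewrite /is_composition.
  by rewrite /= => /eqP N1; rewrite -N1 in N0.
by move=> /andP[_ /eqP sN]; rewrite mcoef_gjms_value sN.
Qed.

End JuhlCoefficients.

(** * Polynomials in an operator that is linear on a subspace *)

Section OperatorPolynomials.
Context (R : fieldType) (V : lmodType R) (S : V -> Prop) (D : V -> V).
Context (S_D : forall u, S u -> S (D u))
  (S_add : forall u v, S u -> S v -> S (u + v))
  (S_scale : forall (c : R) u, S u -> S (c *: u)) (S_zero : S 0)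
  (D_add : forall u v, S u -> S v -> D (u + v) = D u + D v)
  (D_scale : forall (c : R) u, S u -> D (c *: u) = c *: D u).
Context (f : V) (Sf : S f).

(** The operator p(D) applied to [f].  The operator [D] is linear only on [S],
    so p(D) is made to act on the single vector [f] instead of being formed in an
    algebra of endomorphisms. *)
Definition polyact (p : {poly R}) : V := \sum_(i < size p) p`_i *: iter i D f.

Lemma iter_closed i : S (iter i D f).
Proof. by elim: i => //= i; exact: S_D. Qed.

Lemma polyact_widen (p : {poly R}) K : (size p <= K)%N ->
  polyact p = \sum_(i < K) p`_i *: iter i D f.
Proof.
move=> pK; rewrite /polyact (big_ord_widen K (fun i => p`_i *: iter i D f)) //.
rewrite big_mkcond; apply: eq_bigr => i _; case: ltnP => // pi.
by rewrite nth_default // scale0r.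
Qed.

Lemma polyactD p q : polyact (p + q) = polyact p + polyact q.
Proof.
pose K := maxn (size p) (size q).
rewrite (@polyact_widen _ K) ?size_polyD // (@polyact_widen p K) ?leq_maxl //.
rewrite (@polyact_widen q K) ?leq_maxr // -big_split; apply: eq_bigr => i _.
by rewrite coefD scalerDl.
Qed.

Lemma polyactZ (c : R) p : polyact (c *: p) = c *: polyact p.
Proof.
rewrite (@polyact_widen _ (size p)) ?size_scale_leq // scaler_sumr.
by apply: eq_bigr => i _; rewrite coefZ scalerA.
Qed.

Lemma polyact_sum (I : Type) (r : seq I) (P : pred I) (p : I -> {poly R}) :
  polyact (\sum_(i <- r | P i) p i) = \sum_(i <- r | P i) polyact (p i).
Proof.
apply: (big_morph polyact polyactD).
by rewrite /polyact size_poly0 big_ord0.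
Qed.

Lemma polyact1 : polyact 1 = f.
Proof. by rewrite /polyact size_poly1 big_ord1 coef1 scale1r. Qed.

Lemma linear_on_sum (n : nat) (u : 'I_n -> V) : (forall i, S (u i)) ->
  S (\sum_(i < n) u i) /\ D (\sum_(i < n) u i) = \sum_(i < n) D (u i).
Proof.
move=> Su; elim: n u Su => [|n IHn] u Su.
  rewrite !big_ord0; split=> //.
  by rewrite -[X in D X](scale0r 0) D_scale // scale0r.
rewrite !big_ord_recr /=;
have [Ss Ds] := IHn _ (fun i => Su (widen_ord (leqnSn n) i)).
by split; [exact: S_add|rewrite D_add // Ds].
Qed.

Lemma polyactXM p : polyact ('X * p) = D (polyact p).
Proof.
rewrite (linear_on_sum _).2; last by move=> i; apply: S_scale; exact: iter_closed.
rewrite mulrC (@polyact_widen _ (size p).+1); last first.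
  by rewrite (leq_trans (size_polyMleq _ _)) // size_polyX addn2.
rewrite big_ord_recl coefMX /= scale0r add0r; apply: eq_bigr => i _.
by rewrite coefMX /= D_scale //; exact: iter_closed.
Qed.

End OperatorPolynomials.

Lemma big_comp_intertwine (A : pzRingType) (V I : Type) (s : seq I)
    (T : I -> V -> V) (a : I -> A) (Psi : A -> V) :
  (forall i p, T i (Psi p) = Psi (a i * p)) ->
  forall p, (\big[comp/id]_(i <- s) T i) (Psi p) = Psi ((\prod_(i <- s) a i) * p).
Proof.
move=> TPsi p; elim: s => [|i s IHs]; first by rewrite !big_nil mul1r.
by rewrite !big_cons /= IHs TPsi mulrA.
Qed.

(** Otherwise the difference would have the roots 0, 1, 2, and so on. *)
Lemma poly_eq_horner (F : numFieldType) (p q : {poly F}) :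
  (forall x, p.[x] = q.[x]) -> p = q.
Proof.
move=> pq; apply/eqP; rewrite -subr_eq0; apply: contraT => d0.
have := @max_poly_roots _ (p - q) [seq i%:R | i <- iota 0 (size (p - q))] d0.
rewrite size_map size_iota ltnn => H; apply: H.
  by apply/allP => x _; rewrite rootE hornerD hornerN pq subrr.
rewrite map_inj_uniq ?iota_uniq // => i j /eqP.
by rewrite eqr_nat => /eqP.
Qed.

(** * The GJMS operators as polynomials in P_2 *)

Definition gjms_poly (F : numFieldType) (j : nat) : {poly F} :=
  \prod_(k < j) ('X + (k * k.+1)%:R).

Lemma horner_gjms_poly (F : numFieldType) (j : nat) (x : F) :
  (gjms_poly F j).[x] = gjms_value x j.
Proof.
rewrite /gjms_poly horner_prod; apply: eq_bigr => k _.
by rewrite hornerD hornerX -polyC_natr hornerC.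
Qed.

Section GJMSPolynomials.
Context (R : realType) (n : nat).
Implicit Types f : sphere R n -> R.

Definition P2 f : sphere R n -> R :=
  laplacian f - (n%:R / 2 * (n%:R / 2 - 1)) *: f.

(** With j = n/2 + k one has j (n - 1 - j) = n/2 (n/2 - 1) - k (k + 1). *)
Lemma GJMS_factorE k f :
  GJMS_factor (n%:R / 2 + k%:R) f = P2 f + (k * k.+1)%:R *: f.
Proof.
apply/funext => p.
rewrite -[LHS]/(laplacian f p - _ * f p).
rewrite -[RHS]/(laplacian f p - _ * f p + _ * f p).
by rewrite natrM -natr1; field.
Qed.

Lemma smooth_P2 f : smooth f -> smooth (P2 f).
Proof.
move=> sf; rewrite /P2 -scaleNr; apply: smoothD; first exact: smooth_laplacian.
exact: smoothZ.
Qed.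

Lemma P2D f g : smooth f -> smooth g -> P2 (f + g) = P2 f + P2 g.
Proof.
by move=> sf sg; rewrite /P2 laplacianD // scalerDr opprD addrACA.
Qed.

Lemma P2Z (c : R) f : smooth f -> P2 (c *: f) = c *: P2 f.
Proof.
move=> sf; rewrite /P2 laplacianZ // scalerBr !scalerA; congr (_ - _ *: _).
exact: mulrC.
Qed.

Lemma GJMS_polyact f (j : nat) p : smooth f ->
  GJMS j (polyact P2 f p) = polyact P2 f (gjms_poly R j * p).
Proof.
move=> sf; apply: big_comp_intertwine => k {}p.
rewrite GJMS_factorE mulrDl polyactD -polyC_natr mul_polyC polyactZ.
rewrite (polyactXM (S := @smooth R n)) //.
- exact: smooth_P2.
- exact: smoothD.
- exact: smoothZ.
- exact: smooth0.
- exact: P2D.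
- exact: P2Z.
Qed.

End GJMSPolynomials.

Theorem theorem6p1 (R : realType) (n : nat) (hn : (3 <= n)%N) (N : nat)
    (hN : (1 <= N)%N) (f : sphere R n -> R) (hf : smooth f) :
  calM N f = (N`! * N.-1`!)%:R *: GJMS 1 f.
Proof.
have GP j p : GJMS j (polyact (@P2 R n) f p) =
    polyact (@P2 R n) f (gjms_poly R j * p).
  exact: GJMS_polyact.
have GsP I : GJMS_seq I f = polyact (@P2 R n) f (\prod_(i <- I) gjms_poly R i).
  by rewrite -{1}(polyact1 (@P2 R n) f) /GJMS_seq
    (big_comp_intertwine _ GP) mulr1.
have -> : GJMS 1 f = polyact (@P2 R n) f 'X.
  by rewrite -{1}(polyact1 (@P2 R n) f) GP mulr1 /gjms_poly big_ord1 mul0n addr0.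
rewrite /calM -polyactZ.
transitivity (polyact (@P2 R n) f (\sum_(r < N.+1)
    \sum_(I : r.-tuple 'I_N.+1 | is_composition N (map val I))
      mcoef R (map val I) *: \prod_(i <- map val I) gjms_poly R i)).
  rewrite polyact_sum; apply: eq_bigr => r _.
  rewrite polyact_sum; apply: eq_bigr => I _.
  by rewrite polyactZ GsP.
congr polyact; apply: poly_eq_horner => x.
rewrite hornerZ hornerX -(@sum_mcoef_gjms_value R x N N.+1) // horner_sum.
apply: eq_bigr => r _; rewrite horner_sum; apply: eq_bigr => I _.
rewrite hornerZ horner_prod; congr (_ * _).
by apply: eq_bigr => i _; rewrite horner_gjms_poly.
Qed.
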